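(* Let $A\in\mathbb{R}^{n\times n}$ be a diagonal matrix. Then $$\left\{\begin{pmatrix}\langle A,X\rangle-\gamma\\ \pi_{\mathcal{T}}(X)\end{pmatrix}:\ X\in\mathrm{O}(n),\ \gamma\ge0\right\}=\left\{\begin{pmatrix}\langle A,X\rangle-\gamma\\ \pi_{\mathcal{T}}(X)\end{pmatrix}:\ X\in\mathbb{B}_{\mathrm{op}}(n),\ \gamma\ge0\right\}.$$ If additionally $\det(A)\ge0$, then $$\left\{\begin{pmatrix}\langle A,X\rangle-\gamma\\ \pi_{\mathcal{T}}(X)\end{pmatrix}:\ X\in\mathrm{SO}(n),\ \gamma\ge0\right\}=\left\{\begin{pmatrix}\langle A,X\rangle-\gamma\\ \pi_{\mathcal{T}}(X)\end{pmatrix}:\ X\in\mathbb{B}_{\mathrm{op}}(n),\ \gamma\ge0\right\}.$$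
   Context: $\mathrm{O}(n)=\{X\in\mathbb{R}^{n\times n}:X^\intercal X=I\}$; $\mathrm{SO}(n)=\{X\in\mathrm{O}(n):\det(X)=1\}$; $\mathbb{B}_{\mathrm{op}}(n)=\{X\in\mathbb{R}^{n\times n}:\|X\|_{\mathrm{op}}\le1\}$ is the operator norm (maximum singular value) ball. $\langle A,X\rangle=\operatorname{tr}(A^\intercal X)$, and $\gamma$ ranges over real numbers. The map $\pi_{\mathcal{T}}:\mathbb{R}^{n\times n}\to\mathbb{R}^{\binom n2}$, $\pi_{\mathcal{T}}(X)=(X_{ij})_{i<j}$, is the projection onto the strictly upper triangular entries. *)

(* Defs.v *)
From mathcomp Require Import all_boot all_order all_algebra.
From mathcomp Require Import classical_sets reals.

Set Implicit Arguments.
Unset Strict Implicit.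
Unset Printing Implicit Defensive.

Import Order.TTheory GRing.Theory Num.Theory.

Local Open Scope classical_set_scope.
Local Open Scope ring_scope.

Definition orthogonal_group (R : realType) (n : nat) : set 'M[R]_n :=
  [set X | X^T *m X = 1%:M].

Definition special_orthogonal_group (R : realType) (n : nat) : set 'M[R]_n :=
  [set X | orthogonal_group X /\ \det X = 1].

Definition euclidean_norm (R : realType) (n : nat) (v : 'cV[R]_n) : R :=
  Num.sqrt (\sum_i v i 0 ^+ 2).

(* The supremum is taken over a nonempty bounded set ([opnorm_has_sup]), so
   the default value of [sup] never occurs.  The closed unit ball, rather than
   the unit sphere, keeps that set nonempty when [n = 0]. *)
Definition opnorm (R : realType) (n : nat) (X : 'M[R]_n) : R :=
  sup [set euclidean_norm (X *m v) | v in [set v | euclidean_norm v <= 1]].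

Lemma opnorm_has_sup (R : realType) (n : nat) (X : 'M[R]_n) :
  has_sup [set euclidean_norm (X *m v) | v in [set v | euclidean_norm v <= 1]].
Proof.
split.
  exists (euclidean_norm (X *m 0)), 0 => //=.
  rewrite /euclidean_norm big1 ?sqrtr0 // => i _.
  by rewrite mxE expr0n.
exists (Num.sqrt (\sum_i (\sum_j `|X i j|) ^+ 2)) => _ [v /= v_le1 <-].
have sum_ge0 m (u : 'I_m -> R) : 0 <= \sum_i u i ^+ 2.
  by apply: sumr_ge0 => i _; apply: sqr_ge0.
have vj_le1 j : `|v j 0| <= 1.
  apply: le_trans v_le1; rewrite -sqrtr_sqr ler_sqrt ?sum_ge0 //.
  by rewrite (bigD1 j) //= lerDl; apply: sumr_ge0 => i _; apply: sqr_ge0.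
rewrite ler_sqrt ?sum_ge0 //; apply: ler_sum => i _.
rewrite -real_normK ?num_real // lerXn2r ?nnegrE ?sumr_ge0 //.
rewrite mxE; apply: (le_trans (ler_norm_sum _ _ _)); apply: ler_sum => j _.
by rewrite normrM ler_piMr.
Qed.

Definition opnorm_ball (R : realType) (n : nat) : set 'M[R]_n :=
  [set X | opnorm X <= 1].

Definition frobenius_inner (R : realType) (n : nat) (A X : 'M[R]_n) : R :=
  \tr (A^T *m X).

Notation upper_index n := {p : 'I_n * 'I_n | (p.1 < p.2)%N}.

Lemma card_upper_index (n : nat) : #|{: upper_index n}| = 'C(n, 2).
Proof.
rewrite card_sig -sum1_card -bin2_sum big_mkord.
rewrite (eq_bigl (fun p : 'I_n * 'I_n => true && (p.1 < p.2)%N)) //.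
rewrite -(pair_big_dep xpredT (fun i j : 'I_n => (i < j)%N) (fun _ _ => 1%N)).
rewrite (exchange_big_dep xpredT) //=; apply: eq_bigr => j _.
by rewrite -(big_ord_widen n (fun=> 1%N) (ltnW (ltn_ord j))) sum1_card card_ord.
Qed.

(* The coordinates of R^(n choose 2) are matched with the pairs i < j through
   the enumeration of [upper_index n]. *)
Definition upper_proj (R : realType) (n : nat) (X : 'M[R]_n) :
    'cV[R]_('C(n, 2)) :=
  \col_k let p := val (enum_val (cast_ord (esym (card_upper_index n)) k)) in
         X p.1 p.2.

Lemma upper_projP (R : realType) (n : nat) (X Y : 'M[R]_n) :
  upper_proj X = upper_proj Y <-> forall i j : 'I_n, (i < j)%N -> X i j = Y i j.
Proof.
split=> [XY i j ij | XY]; last first.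
  by apply/colP => k; rewrite !mxE /=; apply: XY; case: (enum_val _).
pose p : upper_index n := exist _ (i, j) ij.
have /colP/(_ (cast_ord (card_upper_index n) (enum_rank p))) := XY.
by rewrite !mxE cast_ordK enum_rankK.
Qed.

Definition hypo_proj (R : realType) (n : nat) (A X : 'M[R]_n) (g : R) :
    'cV[R]_(1 + 'C(n, 2)) :=
  col_mx (frobenius_inner A X - g)%:M (upper_proj X).

(* Main.v *)
(* Maximizers over the operator norm ball B of a linear functional <Z, .> with
   Z invertible are orthogonal, and their determinant has the sign of det Z.
   Given X in B and a diagonal invertible D, let Y maximize the concave function
   <D, Y> - k |pi_T(Y - X)|^2 over B.  By the first-order condition, Y also
   maximizes <Z, .> for Z = D - 2k pi_T(Y - X), which is triangular with the
   diagonal of D; hence Y is orthogonal, with the sign of det D, and comparing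
   with the value at X gives <D, Y> >= <D, X> + k |pi_T(Y - X)|^2.  As k -> oo
   and D -> A, compactness of O(n), or of SO(n), yields an orthogonal Y with
   pi_T(Y) = pi_T(X) and <A, Y> >= <A, X>. *)

Require Import Defs.
From mathcomp Require Import all_boot all_order all_algebra.
From mathcomp Require Import ring lra.
From mathcomp Require Import boolp classical_sets reals topology.
From mathcomp Require Import normedtype derive.

Set Implicit Arguments.
Unset Strict Implicit.
Unset Printing Implicit Defensive.

Import Order.TTheory GRing.Theory Num.Theory numFieldNormedType.Exports.

Local Open Scope classical_set_scope.
Local Open Scope ring_scope.

(** * The trace inner product on rectangular matrices *)

Section MatrixInnerProduct.
Context {R : realType}.

(** Rectangular shapes let the same form serve for column vectors, where [mxdot v v] is the squared
    Euclidean norm. On square matrices it is convertible to [frobenius_inner]. *)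
Definition mxdot {m n : nat} (X Y : 'M[R]_(m, n)) : R := \tr (X^T *m Y).

Lemma mxdotE {m n} (X Y : 'M[R]_(m, n)) :
  mxdot X Y = \sum_j \sum_i X i j * Y i j.
Proof.
by apply: eq_bigr => j _; rewrite mxE; apply: eq_bigr => i _; rewrite mxE.
Qed.

Lemma mxdotC {m n} (X Y : 'M[R]_(m, n)) : mxdot X Y = mxdot Y X.
Proof. by rewrite /mxdot -mxtrace_tr trmx_mul trmxK. Qed.

Lemma mxdotDr {m n} (X Y Z : 'M[R]_(m, n)) :
  mxdot X (Y + Z) = mxdot X Y + mxdot X Z.
Proof. by rewrite /mxdot mulmxDr mxtraceD. Qed.

Lemma mxdotZr {m n} a (X Y : 'M[R]_(m, n)) : mxdot X (a *: Y) = a * mxdot X Y.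
Proof. by rewrite /mxdot -scalemxAr mxtraceZ. Qed.

Lemma mxdotNr {m n} (X Y : 'M[R]_(m, n)) : mxdot X (- Y) = - mxdot X Y.
Proof. by rewrite -scaleN1r mxdotZr mulN1r. Qed.

Lemma mxdotDl {m n} (X Y Z : 'M[R]_(m, n)) :
  mxdot (X + Y) Z = mxdot X Z + mxdot Y Z.
Proof. by rewrite mxdotC mxdotDr !(mxdotC Z). Qed.

Lemma mxdotZl {m n} a (X Y : 'M[R]_(m, n)) : mxdot (a *: X) Y = a * mxdot X Y.
Proof. by rewrite mxdotC mxdotZr (mxdotC Y). Qed.

Lemma mxdotNl {m n} (X Y : 'M[R]_(m, n)) : mxdot (- X) Y = - mxdot X Y.
Proof. by rewrite mxdotC mxdotNr (mxdotC Y). Qed.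

Definition mxdot_lin :=
  (@mxdotDl, @mxdotDr, @mxdotNl, @mxdotNr, @mxdotZl, @mxdotZr).

Lemma mxdotMl {m n p} (X : 'M[R]_(m, n)) (Y : 'M[R]_(n, p)) (Z : 'M[R]_(m, p)) :
  mxdot (X *m Y) Z = mxdot Y (X^T *m Z).
Proof. by rewrite /mxdot trmx_mul mulmxA. Qed.

Lemma mxdotMr {m n p} (X : 'M[R]_(m, n)) (Y : 'M[R]_(n, p)) (Z : 'M[R]_(m, p)) :
  mxdot (X *m Y) Z = mxdot X (Z *m Y^T).
Proof. by rewrite /mxdot trmx_mul -mulmxA mxtrace_mulC mulmxA. Qed.

Lemma mxdot_tr {m n} (X Y : 'M[R]_(m, n)) : mxdot X^T Y^T = mxdot X Y.
Proof.
by rewrite /mxdot trmxK mxtrace_mulC -[LHS]mxtrace_tr trmx_mul !trmxK.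
Qed.

Lemma mxdot_ge0 {m n} (X : 'M[R]_(m, n)) : 0 <= mxdot X X.
Proof.
by rewrite mxdotE; do 2!apply: sumr_ge0 => ? _; rewrite -expr2 sqr_ge0.
Qed.

Lemma mxdot_eq0 {m n} (X : 'M[R]_(m, n)) : (mxdot X X == 0) = (X == 0).
Proof.
apply/eqP/eqP => [|->]; last by rewrite /mxdot mulmx0 mxtrace0.
rewrite mxdotE => X0; apply/matrixP => i j; rewrite mxE; apply/eqP.
have sq_ge0 (k l : _) : true -> 0 <= X k l * X k l by rewrite -expr2 sqr_ge0.
have/psumr_eq0P/(_ X0)/(_ j isT) : forall l, true -> 0 <= \sum_k X k l * X k l.
  by move=> l _; apply: sumr_ge0 => k; apply: sq_ge0.
by move/(psumr_eq0P (sq_ge0^~ j))/(_ i isT)/eqP; rewrite mulf_eq0 orbb.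
Qed.

Lemma mxdot_le {m n} (X Y : 'M[R]_(m, n)) :
  2 * mxdot X Y <= mxdot X X + mxdot Y Y.
Proof. by have := mxdot_ge0 (X - Y); rewrite !mxdot_lin (mxdotC Y X); lra. Qed.

Lemma mxdot_sqr_entry {m n} (X : 'M[R]_(m, n)) i j : X i j ^+ 2 <= mxdot X X.
Proof.
rewrite mxdotE (bigD1 j) //= (bigD1 i) //= -expr2 -addrA lerDl addr_ge0 //.
  by apply: sumr_ge0 => k _; rewrite -expr2 sqr_ge0.
by do 2!apply: sumr_ge0 => ? _; rewrite -expr2 sqr_ge0.
Qed.

Lemma mxdot_CauchySchwarz {m n} (X Y : 'M[R]_(m, n)) :
  mxdot X Y ^+ 2 <= mxdot X X * mxdot Y Y.
Proof.
have [->|Y0] := eqVneq Y 0.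
  by rewrite /mxdot !mulmx0 mxtrace0 expr0n mulr0.
have dY : 0 < mxdot Y Y by rewrite lt_neqAle mxdot_ge0 eq_sym mxdot_eq0 Y0.
have := mxdot_ge0 (mxdot Y Y *: X - mxdot X Y *: Y).
rewrite !mxdot_lin (mxdotC Y X); set a := mxdot X X; set b := mxdot X Y.
rewrite (_ : _ + _ = mxdot Y Y * (a * mxdot Y Y - b ^+ 2)); last by ring.
by rewrite pmulr_rge0 // subr_ge0.
Qed.

(** Cauchy-Schwarz applied to every entry of the product, a row of X against a column of Y. *)
Lemma mxdot_mulmx_le {m n p} (X : 'M[R]_(m, n)) (Y : 'M[R]_(n, p)) :
  mxdot (X *m Y) (X *m Y) <= mxdot X X * mxdot Y Y.
Proof.
have row_colE i j : (X *m Y) i j = mxdot (row i X)^T (col j Y).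
  by rewrite mxdotE big_ord1 mxE; apply: eq_bigr => k _; rewrite !mxE.
have dotXE : mxdot X X = \sum_i mxdot (row i X)^T (row i X)^T.
  rewrite mxdotE exchange_big /=; apply: eq_bigr => i _.
  by rewrite mxdotE big_ord1; apply: eq_bigr => k _; rewrite !mxE.
have dotYE : mxdot Y Y = \sum_j mxdot (col j Y) (col j Y).
  rewrite mxdotE; apply: eq_bigr => j _.
  by rewrite mxdotE big_ord1; apply: eq_bigr => k _; rewrite !mxE.
rewrite dotXE dotYE mulr_sumr mxdotE; apply: ler_sum => j _.
rewrite mulr_suml; apply: ler_sum => i _.
by rewrite row_colE -expr2 mxdot_CauchySchwarz.
Qed.

End MatrixInnerProduct.

(** Divide by t and let t tend to 0. This turns maximality along a path into a first-order
    condition. *)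
Lemma le0_of_quadratic_bound {R : realFieldType} (a b : R) :
  (forall t, 0 < t -> t <= 1 -> a * t <= b * t ^+ 2) -> a <= 0.
Proof.
move=> ab; rewrite leNgt; apply/negP => a0.
have b0 : 0 < `|b| + 1 by rewrite ltr_wpDl.
(* This t makes b t at most a / 2, against a <= b t. *)
pose t := Num.min 1 (a / (2 * (`|b| + 1))).
have t0 : 0 < t by rewrite /t lt_min ltr01 divr_gt0 // mulr_gt0.
have := ab t t0; rewrite /t ge_min lexx => /(_ isT).
rewrite -/t expr2 mulrA ler_pM2r //.
have : t * (2 * (`|b| + 1)) <= a.
  by rewrite -ler_pdivlMr ?mulr_gt0 // /t ge_min lexx orbT.
have : b * t <= `|b| * t by rewrite ler_wpM2r ?ler_norm // ltW.
lra.
Qed.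

(** * Contractions of Euclidean space *)

Section Contractions.
Context {R : realType} {n : nat}.
Implicit Types (U X Y Z S M : 'M[R]_n) (v : 'cV[R]_n).

(** Squared norms avoid both the square root and the supremum; [opnorm_ballE] identifies these
    matrices with the operator norm ball. *)
Definition contraction X :=
  forall v, mxdot (X *m v) (X *m v) <= mxdot v v.

(** With w = X^T v, 2 |w|^2 = 2 <v, X w> <= |v|^2 + |X w|^2 <= |v|^2 + |w|^2. *)
Lemma contraction_tr X : contraction X -> contraction X^T.
Proof.
move=> cX v.
have := mxdot_le v (X *m (X^T *m v)); have := cX (X^T *m v).
have : mxdot v (X *m (X^T *m v)) = mxdot (X^T *m v) (X^T *m v).
  by rewrite mxdotC mxdotMl.
lra.
Qed.

Lemma contraction_mul X Y :
  contraction X -> contraction Y -> contraction (X *m Y).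
Proof. by move=> cX cY v; rewrite -mulmxA (le_trans (cX _)). Qed.

Lemma contraction_convex X Y t : 0 <= t <= 1 ->
  contraction X -> contraction Y -> contraction (X + t *: (Y - X)).
Proof.
move=> /andP[t0 t1] cX cY v.
have := cX v; have := cY v; have := mxdot_ge0 (X *m v - Y *m v).
rewrite mulmxDl -scalemxAl mulmxBl !mxdot_lin (mxdotC (Y *m v) (X *m v)).
set x := mxdot (X *m v) _; set y := mxdot (Y *m v) _.
set z := mxdot (X *m v) (Y *m v); set w := mxdot v v => q1 q2 q3.
(* For p = X v and q = Y v, |(1 - t) p + t q|^2 = (1 - t) |p|^2 + t |q|^2 - t (1 - t) |p - q|^2. *)
have : 0 <= (1 - t) * t * (x - z + (- z + y)).
  by apply: mulr_ge0; [apply: mulr_ge0; lra|lra].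
have : 0 <= (1 - t) * (w - x) by apply: mulr_ge0; lra.
have : 0 <= t * (w - y) by apply: mulr_ge0; lra.
lra.
Qed.

Lemma orthogonal_contraction X : X^T *m X = 1%:M -> contraction X.
Proof. by move=> XX v; rewrite mxdotMl mulmxA XX mul1mx. Qed.

Lemma contraction_entry X i j : contraction X -> `|X i j| <= 1.
Proof.
move=> cX; have := cX (delta_mx j 0); rewrite -colE.
have -> : mxdot (delta_mx j 0 : 'cV[R]_n) (delta_mx j 0) = 1.
  rewrite mxdotE big_ord1 (bigD1 j) //= big1 ?addr0 ?mxE ?eqxx ?mulr1 //.
  by move=> k kj; rewrite mxE (negbTE kj) mul0r.
have := mxdot_sqr_entry (col j X) i 0; rewrite mxE => /le_trans/[apply].
by rewrite -real_normK ?num_real // expr_le1.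
Qed.

End Contractions.

(** * Maximizers of a linear functional over the contractions *)

Section LinearMaximizers.
Context {R : realType} {n : nat}.
Implicit Types (U X Y Z : 'M[R]_n) (v : 'cV[R]_n).

Definition contraction_argmax Z U :=
  contraction U /\ forall W, contraction W -> mxdot Z W <= mxdot Z U.

Lemma argmax_tr Z U : contraction_argmax Z U -> contraction_argmax Z^T U^T.
Proof.
case=> cU maxU; split=> [|W cW]; first exact: contraction_tr.
by rewrite -[W]trmxK !mxdot_tr; apply/maxU/contraction_tr.
Qed.

(** Let P = U^T Z and let S = P - P^T, which is skew-symmetric. To first order in t, U (1 + t S)
    remains a contraction, so maximality gives <P, S> <= 0. Since <P, S> = |S|^2 / 2, S vanishes. *)
Lemma argmax_sym Z U : contraction_argmax Z U -> (U^T *m Z)^T = U^T *m Z.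
Proof.
case=> cU maxU; set P := U^T *m Z.
have [S SE] : exists S, S = P - P^T by exists (P - P^T).
have ST : S^T = - S by rewrite SE linearB /= trmxK opprB.
set c := mxdot S S.
have PE K : mxdot Z (U *m K) = mxdot P K by rewrite mxdotC mxdotMl mxdotC.
have trSP : 2 * mxdot P S = c.
  have PTS : mxdot P^T S = - mxdot P S.
    by rewrite -[LHS]mxdot_tr trmxK ST mxdotNr.
  by rewrite /c {2}SE mxdotDl mxdotNl PTS; ring.
suff c0 : c <= 0.
  have: c == 0 by rewrite eq_le c0 mxdot_ge0.
  by rewrite mxdot_eq0 SE subr_eq0 => /eqP <-.
suff : mxdot P S <= 0 by lra.
apply: (@le0_of_quadratic_bound _ _ (c * mxdot P 1%:M)) => t t0 _.
(* For S skew-symmetric, |(1 + t S) v|^2 = |v|^2 + t^2 |S v|^2 <= d |v|^2. *)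
set d := 1 + c * t ^+ 2.
have c0 : 0 <= c := mxdot_ge0 _.
have d1 : 1 <= d by rewrite lerDl mulr_ge0 // sqr_ge0.
have d0 : 0 < d by lra.
have skewS v : mxdot v (S *m v) = 0.
  have : mxdot v (S *m v) = - mxdot v (S *m v).
    by rewrite {1}mxdotC mxdotMl ST mulNmx mxdotNr.
  lra.
(* Dividing by d instead of its square root still gives a contraction because d >= 1, and it costs
   only a term of order t^2. *)
have cK : contraction (d^-1 *: (1%:M + t *: S)).
  move=> v; rewrite -scalemxAl mulmxDl mul1mx -scalemxAl !mxdot_lin.
  rewrite (mxdotC _ v) skewS !(mulr0, addr0, add0r) mulrA.
  rewrite -invrM ?unitfE ?gt_eqF //.
  rewrite ler_pdivrMl ?mulr_gt0 //.
  have := mxdot_mulmx_le S v; rewrite -/c; have := mxdot_ge0 v.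
  set x := mxdot v v; set y := mxdot _ _ => x0 yx.
  have : t * (t * y) <= c * t ^+ 2 * x.
    by rewrite mulrA -expr2 [leRHS]mulrAC mulrC ler_wpM2r ?sqr_ge0.
  rewrite /d; set e := c * t ^+ 2.
  have e0 : 0 <= e by rewrite mulr_ge0 // sqr_ge0.
  nra.
(* Multiplied by d, maximality reads <P, 1> + t <P, S> <= (1 + c t^2) <P, 1>. *)
have := maxU _ (contraction_mul cU cK).
rewrite PE -[mxdot Z U]mulr1 -[U in mxdot Z U]mulmx1 PE mulr1.
rewrite !mxdot_lin ler_pdivrMl // /d.
rewrite mulrDl mul1r lerD2l; nra.
Qed.

(** Compare U with U (1 - v v^T / |v|^2), which is U after the orthogonal projection along v: the
    functional drops by <v, U^T Z v> / |v|^2. *)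
Lemma argmax_psd Z U v : contraction_argmax Z U -> 0 <= mxdot v (U^T *m Z *m v).
Proof.
case=> cU maxU; set P := U^T *m Z.
have [->|v0] := eqVneq v 0; first by rewrite mulmx0 /mxdot mulmx0 mxtrace0.
have d0 : 0 < mxdot v v by rewrite lt_neqAle mxdot_ge0 eq_sym mxdot_eq0 v0.
have cK : contraction (1%:M - (mxdot v v)^-1 *: (v *m v^T)).
  move=> w; rewrite mulmxBl mul1mx -scalemxAl -mulmxA.
  have -> : v^T *m w = (mxdot v w)%:M.
    by rewrite [LHS]mx11_scalar /mxdot /mxtrace big_ord1.
  rewrite mul_mx_scalar !mxdot_lin (mxdotC w v).
  set x := mxdot w w; set y := mxdot v w; rewrite -/(mxdot v v).
  have -> : (mxdot v v)^-1 * (y * ((mxdot v v)^-1 * (y * mxdot v v))) =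
    (mxdot v v)^-1 * y ^+ 2 by field; rewrite gt_eqF.
  have : 0 <= (mxdot v v)^-1 * y ^+ 2.
    by rewrite mulr_ge0 ?invr_ge0 ?mxdot_ge0 ?sqr_ge0.
  nra.
have := maxU _ (contraction_mul cU cK).
rewrite mulmxBr mulmx1 !mxdot_lin gerBl // -scalemxAr mxdotZr.
rewrite pmulr_rge0 ?invr_gt0 //; congr (_ <= _).
rewrite mxdotC mxdotMl -/P -mxdotC.
by rewrite mxdotC mxdotMr trmxK.
Qed.

(** Put M = 1 - U^T U. The direction E = (1 - U U^T) Z M equals Z M M, so <Z, E> = |Z M|^2.
    Maximality along E forces Z M = 0, and M = 0 follows by inverting Z. *)
Lemma argmax_orthogonal Z U :
  Z \in unitmx -> contraction_argmax Z U -> U^T *m U = 1%:M.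
Proof.
move=> uZ ZU; have [cU maxU] := ZU.
(* U + e E is a contraction for small e > 0, because both |E v|^2 and
   <U v, E v> = <U M v, Z M v> are O(|M v|^2), while
   |v|^2 - |U v|^2 = <v, M v> >= |M v|^2. *)
set M := 1%:M - U^T *m U; set E := (1%:M - U *m U^T) *m (Z *m M).
have MT : M^T = M by rewrite /M linearB /= trmx1 trmx_mul trmxK.
have NT : (1%:M - U *m U^T)^T = 1%:M - U *m U^T.
  by rewrite linearB /= trmx1 trmx_mul trmxK.
have UM : U *m M = (1%:M - U *m U^T) *m U.
  by rewrite /M mulmxBr mulmxBl mulmx1 mul1mx mulmxA.
(* Both U^T Z and U Z^T are symmetric, so U U^T Z = U Z^T U = Z U^T U. *)
have ZM : (1%:M - U *m U^T) *m Z = Z *m M.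
  rewrite /M mulmxBr mulmxBl mulmx1 mul1mx -mulmxA -(argmax_sym ZU).
  rewrite trmx_mul trmxK.
  have := argmax_sym (argmax_tr ZU); rewrite !trmxK trmx_mul !trmxK => UZ.
  by rewrite mulmxA -UZ -mulmxA.
have EZ : mxdot Z E = mxdot (Z *m M) (Z *m M).
  by rewrite mxdotMr MT /E mulmxA ZM.
suff : mxdot Z E <= 0.
  rewrite EZ => ZM0; have : mxdot (Z *m M) (Z *m M) == 0.
    by rewrite eq_le ZM0 mxdot_ge0.
  rewrite mxdot_eq0 => /eqP/(congr1 (mulmx (invmx Z))).
  by rewrite mulmx0 mulKmx // => /eqP; rewrite subr_eq0 => /eqP.
set b := mxdot U U + mxdot Z Z.
set c := mxdot ((1%:M - U *m U^T) *m Z) ((1%:M - U *m U^T) *m Z).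
have b0 : 0 <= b by rewrite addr_ge0 ?mxdot_ge0.
have c0 : 0 <= c := mxdot_ge0 _.
(* With m = |M v|^2 and e <= 1, passing from U to U + e E raises |U v|^2 by at most e (b + c) m;
   this e keeps the rise below m. *)
set e := (1 + b + c)^-1.
have e0 : 0 < e by rewrite invr_gt0; lra.
have eE : e * (1 + b + c) = 1 by rewrite mulVf // gt_eqF //; lra.
have cE : contraction (U + e *: E).
  move=> v; rewrite mulmxDl -scalemxAl !mxdot_lin (mxdotC (E *m v)).
  have UE : mxdot (U *m v) (E *m v) = mxdot (U *m (M *m v)) (Z *m (M *m v)).
    rewrite mxdotC /E -[_ *m _ *m v]mulmxA mxdotMl NT.
    by rewrite mxdotC mulmxA -UM -!mulmxA.
  have vM : mxdot (M *m v) (M *m v) <= mxdot v v - mxdot (U *m v) (U *m v).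
    have := contraction_tr cU (U *m v).
    have vUU : mxdot v (U^T *m (U *m v)) = mxdot (U *m v) (U *m v).
      by rewrite [RHS]mxdotMl.
    rewrite /M mulmxBl mul1mx -mulmxA !mxdot_lin (mxdotC (U^T *m _) v) vUU.
    lra.
  have pcm : mxdot (E *m v) (E *m v) <= c * mxdot (M *m v) (M *m v).
    by rewrite /E !mulmxA -[_ *m M *m v]mulmxA mxdot_mulmx_le.
  have := mxdot_le (U *m (M *m v)) (Z *m (M *m v)).
  have := mxdot_mulmx_le U (M *m v); have := mxdot_mulmx_le Z (M *m v).
  rewrite UE; move: vM pcm (mxdot_ge0 (M *m v)) (mxdot_ge0 (E *m v)).
  move: (mxdot (Z *m _) (Z *m _)) (mxdot (U *m (M *m v)) (U *m _)) => r s.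
  move: (mxdot (U *m _) (Z *m _)) (mxdot (E *m v) (E *m v)) => q p.
  move: (mxdot (M *m v) (M *m v)) (mxdot (U *m v) (U *m v)) => m y.
  move: (mxdot v v) => x.
  move=> mxy pcm m0 p0 rZ sU q2.
  have qb : 2 * q <= b * m by rewrite /b mulrDl; lra.
  have e1 : e <= 1 by rewrite -eE; nra.
  have ep : e * p <= c * m by nra.
  have : e * (2 * q + e * p) <= e * (b * m + c * m).
    by apply: ler_wpM2l; [exact: ltW|lra].
  have := mulr_ge0 (ltW e0) m0.
  have : e * (1 + b + c) * m = m by rewrite eE mul1r.
  lra.
by have := maxU _ cE; rewrite !mxdot_lin gerDl pmulr_rle0.
Qed.

End LinearMaximizers.

(** The determinant of t + (1 - t) P is a polynomial in t with value 1 at t = 1. If det P were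
    negative, it would have a root in [0, 1]. The root is not 0, as P is invertible; for t > 0 the
    quadratic form is positive definite, so no kernel vector exists. *)
Lemma psd_unitmx_det_gt0 {R : realType} {n : nat} (P : 'M[R]_n) :
  P \in unitmx -> (forall v : 'cV_n, 0 <= mxdot v (P *m v)) -> 0 < \det P.
Proof.
rewrite unitmxE unitfE => P0 psdP; rewrite lt_neqAle eq_sym P0 /= leNgt.
apply/negP => Plt0.
pose Q : 'M[{poly R}]_n := 'X%:M + (1 - 'X) *: map_mx polyC P.
have QE t : (\det Q).[t] = \det (t%:M + (1 - t) *: P).
  rewrite -[LHS]/(horner_eval t (\det Q)) -det_map_mx; congr (\det _).
  apply/matrixP => i j; rewrite !mxE.
  rewrite /= /horner_eval hornerD hornerMn hornerX hornerM.
  by rewrite hornerD hornerN !hornerC hornerX.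
have [|t /andP[t0 t1] /rootP] := @poly_ivt R (\det Q) 0 1 ler01.
  rewrite !QE subr0 subrr scale0r scale1r addr0 det1 ler01 andbT.
  by rewrite raddf0 add0r ltW.
rewrite QE => /eqP/det0P[u u0 uQ].
have tn0 : t != 0.
  apply: contraNneq u0 => t00; move: uQ; rewrite t00 raddf0 add0r subr0 scale1r.
  move/(congr1 (mulmx^~ (invmx P))); rewrite mul0mx mulmxK ?unitmxE ?unitfE //.
  by move=> ->.
have u1 : 0 < mxdot u^T u^T.
  by rewrite lt_neqAle mxdot_ge0 eq_sym mxdot_eq0 trmx_eq0 u0.
have : mxdot u^T ((t%:M + (1 - t) *: P) *m u^T) = 0.
  by rewrite /mxdot trmxK mulmxA uQ mul0mx mxtrace0.
rewrite mulmxDl mul_scalar_mx -scalemxAl !mxdot_lin => /eqP.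
rewrite paddr_eq0; last 2 first.
- by rewrite mulr_ge0 // ltW.
- by rewrite mulr_ge0 ?subr_ge0.
by rewrite mulf_eq0 (negbTE tn0) (gt_eqF u1).
Qed.

(** The product is the determinant of U^T Z, which is invertible with a nonnegative quadratic
    form. *)
Lemma argmax_det_gt0 {R : realType} {n : nat} (Z U : 'M[R]_n) :
  Z \in unitmx -> contraction_argmax Z U -> 0 < \det U * \det Z.
Proof.
move=> uZ ZU; rewrite -det_tr -det_mulmx; apply: psd_unitmx_det_gt0.
  rewrite unitmx_mul uZ andbT.
  by have [] := mulmx1_unit (argmax_orthogonal uZ ZU).
by move=> v; exact: argmax_psd.
Qed.

(** * Strictly upper triangular parts and the penalized functional *)

Section StrictUpperPart.
Context {R : realType} {n : nat}.
Implicit Types (X Y D : 'M[R]_n).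

(** Keeping the coordinates of [upper_proj] in place makes the gradient of the penalty a matrix that
    can be added to D. *)
Definition upper_part X := \matrix_(i, j) if (i < j)%N then X i j else 0.

Lemma upper_partD X Y : upper_part (X + Y) = upper_part X + upper_part Y.
Proof. by apply/matrixP => i j; rewrite !mxE; case: ifP; rewrite ?addr0. Qed.

Lemma upper_partZ a X : upper_part (a *: X) = a *: upper_part X.
Proof. by apply/matrixP => i j; rewrite !mxE; case: ifP; rewrite ?mulr0. Qed.

Lemma mxdot_upper_part X Y :
  mxdot (upper_part X) (upper_part Y) = mxdot (upper_part X) Y.
Proof.
rewrite !mxdotE; apply: eq_bigr => j _; apply: eq_bigr => i _.
by rewrite !mxE; case: ifP; rewrite ?mul0r.
Qed.

Lemma det_diag_addr_upper D X :
  is_diag_mx D -> \det (D + upper_part X) = \det D.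
Proof.
move=> /is_diag_mxP dD.
have dDU (i j : 'I_n) : (i < j)%N -> D i j = 0.
  by move=> ij; apply: dD; rewrite neq_ltn ij.
have dDL (i j : 'I_n) : (i < j)%N -> D j i = 0.
  by move=> ij; apply: dD; rewrite neq_ltn ij orbT.
rewrite -det_tr !det_trig.
- by apply: eq_bigr => i _; rewrite !mxE ltnn addr0.
- by apply/is_trig_mxP.
- apply/is_trig_mxP => i j ij; rewrite !mxE (dDL _ _ ij) add0r.
  by rewrite ltnNge ltnW.
Qed.

Definition penalized (k : R) D X Y : R :=
  mxdot D Y - k * mxdot (upper_part (Y - X)) (upper_part (Y - X)).

(** The matrix is the gradient of the penalized functional at Y. From Y to Y + t (W - Y) the
    functional changes by t times the slope minus k t^2 |V|^2, where V is the upper part of W - Y,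
    so the slope is nonpositive. *)
Lemma penalized_argmax k D X Y : contraction Y ->
  (forall W, contraction W -> penalized k D X W <= penalized k D X Y) ->
  contraction_argmax (D + upper_part ((- (2 * k)) *: (Y - X))) Y.
Proof.
move=> cY maxY; split=> // W cW; set N := upper_part (Y - X).
rewrite upper_partZ -/N -subr_le0.
pose V := upper_part (W - Y).
have -> : mxdot (D + - (2 * k) *: N) W - mxdot (D + - (2 * k) *: N) Y =
    mxdot D (W - Y) - 2 * k * mxdot N V.
  by rewrite mxdot_upper_part -/N !mxdot_lin; ring.
apply: (@le0_of_quadratic_bound _ _ (k * mxdot V V)) => t t0 t1.
have := maxY _ (@contraction_convex _ _ _ _ t _ cY cW).
rewrite (ltW t0) t1 => /(_ isT); rewrite /penalized.
rewrite [Y + _ - X]addrAC (upper_partD (Y - X)) upper_partZ -/N -/V.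
rewrite !mxdot_lin (mxdotC V N).
lra.
Qed.

End StrictUpperPart.

(** * Continuity of matrix-valued maps, tested on entries *)

Section EntrywiseContinuity.
Context {R : realType} {T : topologicalType}.

Definition entrywise_continuous {m n} (f : T -> 'M[R]_(m, n)) :=
  forall i j, continuous (fun x => f x i j).

Lemma continuous_sumr {I : Type} (r : seq I) (P : pred I) (F : I -> T -> R) :
  (forall i, P i -> continuous (F i)) ->
  continuous (fun x => \sum_(i <- r | P i) F i x).
Proof. by apply: continuous_big; exact: add_continuous. Qed.

Lemma continuous_prodr {I : Type} (r : seq I) (P : pred I) (F : I -> T -> R) :
  (forall i, P i -> continuous (F i)) ->
  continuous (fun x => \prod_(i <- r | P i) F i x).
Proof. by apply: continuous_big; exact: mul_continuous. Qed.

Lemma entrywise_continuous_cst {m n} (A : 'M[R]_(m, n)) :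
  entrywise_continuous (fun=> A).
Proof. by move=> i j; exact: cst_continuous. Qed.

Lemma entrywise_continuousB {m n} (f g : T -> 'M[R]_(m, n)) :
  entrywise_continuous f -> entrywise_continuous g ->
  entrywise_continuous (fun x => f x - g x).
Proof.
move=> cf cg i j; under eq_fun do rewrite !mxE.
by move=> x; apply: cvgB; [exact: cf|exact: cg].
Qed.

Lemma entrywise_continuous_tr {m n} (f : T -> 'M[R]_(m, n)) :
  entrywise_continuous f -> entrywise_continuous (fun x => (f x)^T).
Proof. by move=> cf i j; under eq_fun do rewrite mxE; exact: cf. Qed.

Lemma entrywise_continuousM {m n p}
    (f : T -> 'M[R]_(m, n)) (g : T -> 'M[R]_(n, p)) :
  entrywise_continuous f -> entrywise_continuous g ->
  entrywise_continuous (fun x => f x *m g x).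
Proof.
move=> cf cg i j; under eq_fun do rewrite mxE.
apply: continuous_sumr => k _ x; apply: cvgM; [exact: cf|exact: cg].
Qed.

Lemma entrywise_continuous_upper_part {n} (f : T -> 'M[R]_n) :
  entrywise_continuous f -> entrywise_continuous (fun x => upper_part (f x)).
Proof.
move=> cf i j; under eq_fun do rewrite mxE.
by case: (i < j)%N; [exact: cf|exact: cst_continuous].
Qed.

Lemma continuous_mxdot {m n} (f g : T -> 'M[R]_(m, n)) :
  entrywise_continuous f -> entrywise_continuous g ->
  continuous (fun x => mxdot (f x) (g x)).
Proof.
move=> cf cg; apply: continuous_sumr => k _.
by apply: entrywise_continuousM => //; exact: entrywise_continuous_tr.
Qed.

Lemma continuous_det {n} (f : T -> 'M[R]_n) :
  entrywise_continuous f -> continuous (fun x => \det (f x)).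
Proof.
move=> cf; apply: continuous_sumr => s _ x; apply: cvgM; first exact: cvg_cst.
by apply: continuous_prodr => i _; exact: cf.
Qed.

End EntrywiseContinuity.

(** * Compactness of the contractions, of O(n) and of SO(n) *)

Section Compactness.
Context {R : realType} {n : nat}.

Lemma entrywise_continuous_id : entrywise_continuous (@id 'M[R]_n).
Proof. by move=> i j; exact: coord_continuous. Qed.

Lemma continuous_mxdotr (A : 'M[R]_n) : continuous (mxdot A).
Proof.
apply: continuous_mxdot; first exact: entrywise_continuous_cst.
exact: entrywise_continuous_id.
Qed.

Lemma continuous_upper_sqdist (X : 'M[R]_n) :
  continuous
    (fun Y : 'M[R]_n => mxdot (upper_part (Y - X)) (upper_part (Y - X))).
Proof.
have cN : entrywise_continuous (fun Y : 'M[R]_n => upper_part (Y - X)).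
  apply/entrywise_continuous_upper_part/entrywise_continuousB.
    exact: entrywise_continuous_id.
  exact: entrywise_continuous_cst.
exact: continuous_mxdot.
Qed.

Lemma closed_preimage_le (f : 'M[R]_n -> R) a :
  continuous f -> closed [set X | f X <= a].
Proof.
move=> cf; apply: (@preimage_closed _ _ f [set x | x <= a]).
  by move=> x _; exact: cf.
exact: closed_le.
Qed.

Lemma closed_preimage_eq (f : 'M[R]_n -> R) a :
  continuous f -> closed [set X | f X = a].
Proof.
move=> cf; apply: (@preimage_closed _ _ f [set x | x = a]).
  by move=> x _; exact: cf.
exact: closed_eq.
Qed.

(** The cube of matrices is the continuous image under [vec_mx] of a cube of row vectors, where
    [rV_compact] applies. *)
Lemma compact_entry_le1 : compact [set X : 'M[R]_n | forall i j, `|X i j| <= 1].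
Proof.
have -> : [set X : 'M[R]_n | forall i j, `|X i j| <= 1] =
    vec_mx @` [set v : 'rV[R]_(n * n) | forall k, `[-1, 1]%classic (v ord0 k)].
  apply/seteqP; split=> [X X1|_ [v v1 <-] i j].
    exists (mxvec X); last exact: mxvecK.
    move=> k; case/mxvec_indexP: k => i j.
    by rewrite mxvecE /= in_itv /= -ler_norml.
  by rewrite mxE ler_norml; have := v1 (mxvec_index i j); rewrite /= in_itv.
apply: continuous_compact.
  (* A neighbourhood of a matrix contains a product of neighbourhoods of its finitely many entries,
     and each entry of [vec_mx w] is a coordinate of w. *)
  apply: continuous_subspaceT => v A [B nB BA].
  suff : nbhs v [set w : 'rV[R]_(n * n) | forall i j, B i j (vec_mx w i j)].
    by apply: filterS => w Bw; exact: BA.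
  apply: (filter_forall (F := nbhs v)) => i.
  apply: (filter_forall (F := nbhs v)) => j.
  have := nB i j; rewrite mxE => /(@coord_continuous R 1 (n * n) _ _ v).
  by apply: (filterS (F := nbhs v)) => w /=; rewrite mxE.
apply: (@rV_compact R (n * n) (fun=> `[-1, 1]%classic)) => _.
exact: segment_compact.
Qed.

Lemma compact_contraction : compact [set X : 'M[R]_n | contraction X].
Proof.
apply: (subclosed_compact _ compact_entry_le1) => [|X cX i j]; last first.
  exact: contraction_entry.
have -> : [set X : 'M[R]_n | contraction X] =
    \bigcap_(v in [set: 'cV[R]_n])
      [set X | mxdot (X *m v) (X *m v) <= mxdot v v].
  by apply/seteqP; split=> [X cX v _|X cX v]; [exact: cX|exact: (cX v I)].
apply: closed_bigI => v _; apply: closed_preimage_le.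
have cXv : entrywise_continuous (fun X : 'M[R]_n => X *m v).
  apply: entrywise_continuousM; first exact: entrywise_continuous_id.
  exact: entrywise_continuous_cst.
exact: continuous_mxdot.
Qed.

Lemma closed_orthogonal_group : closed (@orthogonal_group R n).
Proof.
(* The matrix equation becomes the vanishing of one continuous real function. *)
have -> : @orthogonal_group R n =
    [set X | mxdot (X^T *m X - 1%:M) (X^T *m X - 1%:M) = 0].
  apply/seteqP; split=> X /=; rewrite /orthogonal_group /=.
    by move=> ->; rewrite subrr /mxdot mulmx0 mxtrace0.
  by move=> /eqP; rewrite mxdot_eq0 subr_eq0 => /eqP.
apply: closed_preimage_eq.
have cf : entrywise_continuous (fun X : 'M[R]_n => X^T *m X - 1%:M).
  apply: entrywise_continuousB; last exact: entrywise_continuous_cst.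
  apply: entrywise_continuousM; last exact: entrywise_continuous_id.
  exact/entrywise_continuous_tr/entrywise_continuous_id.
exact: continuous_mxdot.
Qed.

Lemma compact_orthogonal_group : compact (@orthogonal_group R n).
Proof.
apply: (subclosed_compact closed_orthogonal_group compact_contraction).
exact: orthogonal_contraction.
Qed.

Lemma compact_special_orthogonal_group :
  compact (@special_orthogonal_group R n).
Proof.
apply: (subclosed_compact _ compact_orthogonal_group) => [|X []//].
apply: (closedI closed_orthogonal_group); apply: closed_preimage_eq.
exact/continuous_det/entrywise_continuous_id.
Qed.

End Compactness.

(** * The operator norm ball as the set of contractions *)

Section OperatorNormBall.
Context {R : realType} {n : nat}.

Lemma euclidean_normE (v : 'cV[R]_n) : euclidean_norm v = Num.sqrt (mxdot v v).
Proof.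
by rewrite mxdotE big_ord1; congr Num.sqrt; apply: eq_bigr.
Qed.

Lemma opnorm_ballE : @opnorm_ball R n = [set X | contraction X].
Proof.
apply/seteqP; split=> X; rewrite /opnorm_ball /= => cX; last first.
  apply: ge_sup; first by have [] := opnorm_has_sup X.
  move=> _ [v /= v1 <-]; apply: le_trans v1.
  by rewrite !euclidean_normE ler_sqrt ?mxdot_ge0.
move=> v; have [->|v0] := eqVneq v 0; first by rewrite mulmx0 /mxdot !mulmx0.
have d0 : 0 < mxdot v v by rewrite lt_neqAle mxdot_ge0 eq_sym mxdot_eq0 v0.
set a := Num.sqrt (mxdot v v).
have a0 : 0 < a by rewrite sqrtr_gt0.
have aE : mxdot v v = a ^+ 2 by rewrite sqr_sqrtr ?mxdot_ge0.
(* The supremum bounds X on the unit vector v / |v|; homogeneity then gives the bound at v. *)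
have : euclidean_norm (X *m (a^-1 *: v)) <= 1.
  apply: le_trans cX; apply: ub_le_sup; first by have [] := opnorm_has_sup X.
  exists (a^-1 *: v) => //=; rewrite euclidean_normE !mxdot_lin aE.
  by rewrite expr2 mulKf ?gt_eqF // mulVf ?gt_eqF // sqrtr1.
rewrite euclidean_normE -sqrtr1 ler_sqrt ?ler01 // -scalemxAr !mxdot_lin mulrA.
by rewrite -expr2 exprVn -aE mulrC ler_pdivrMr // mul1r.
Qed.

End OperatorNormBall.

(** * Invertible diagonal perturbations *)

Section DiagonalPerturbation.
Context {R : realType} {n : nat}.

(** Provides the invertible D near A. If det A is nonzero, S = 0 works. Otherwise S is supported on
    the zero diagonal entries of A, with signs chosen so that the determinant becomes positive for
    every e > 0. *)
Lemma diag_perturbation (A : 'M[R]_n) : is_diag_mx A ->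
  exists2 S : 'M[R]_n, is_diag_mx S & forall e, 0 < e ->
    \det (A + e *: S) != 0 /\ (0 <= \det A -> 0 < \det (A + e *: S)).
Proof.
move=> dA.
have [A0|A0] := eqVneq (\det A) 0; last first.
  exists 0 => [|e _]; first by apply/is_diag_mxP => i j _; rewrite mxE.
  by rewrite scaler0 addr0; split=> //; rewrite le_eqVlt eq_sym (negbTE A0).
have det_diagE (D : 'M[R]_n) : is_diag_mx D -> \det D = \prod_i D i i.
  by move=> dD; rewrite det_trig // is_diag_mx_is_trig.
have /eqP := A0; rewrite det_diagE // => /prodf_eq0[i0 _ /eqP Ai0].
pose s i := if A i i == 0 then 1 else 0 : R.
set p := \prod_(i | i != i0) (if A i i == 0 then 1 else A i i).
(* The entry at i0 cancels the sign of the product of the other entries. *)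
pose S : 'M[R]_n := diag_mx (\row_i if i == i0 then Num.sg p else s i).
have SE i : S i i = if i == i0 then Num.sg p else s i.
  by rewrite !mxE eqxx mulr1n.
have dS : is_diag_mx S by exact: diag_mx_is_diag.
exists S => // e e0.
suff : 0 < \det (A + e *: S) by split; rewrite ?gt_eqF.
have -> : \det (A + e *: S) = \prod_i (A i i + e * S i i).
  rewrite det_diagE; first by apply: eq_bigr => i _; rewrite !mxE.
  apply/is_diag_mxP => i j ij; rewrite [LHS]mxE [in X in _ + X]mxE.
  by rewrite (is_diag_mxP dA) // (is_diag_mxP dS) // mulr0 addr0.
rewrite (bigD1 i0) //= Ai0 add0r SE eqxx.
have -> : \prod_(i | i != i0) (A i i + e * S i i) =
    p * \prod_(i | i != i0) (if A i i == 0 then e else 1).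
  rewrite -big_split /=; apply: eq_bigr => i ii0.
  rewrite SE (negbTE ii0) /s; case: eqP => [->|_].
    by rewrite add0r mulr1 mul1r.
  by rewrite mulr0 addr0 mulr1.
set q := \prod_(i | i != i0) _.
have p0 : p != 0.
  by apply/prodf_neq0 => i _; case: ifPn => // _; exact: oner_neq0.
have q0 : 0 < q by apply: prodr_gt0 => i _; case: ifP.
by rewrite -mulrA mulr_gt0 // mulrA mulr_gt0 // -normrEsg normr_gt0.
Qed.

Lemma mxdot_contraction_le (A W : 'M[R]_n) : contraction W ->
  `|mxdot A W| <= \sum_j \sum_i `|A i j|.
Proof.
move=> cW; rewrite mxdotE; apply: (le_trans (ler_norm_sum _ _ _)).
apply: ler_sum => j _; apply: (le_trans (ler_norm_sum _ _ _)).
by apply: ler_sum => i _; rewrite normrM ler_piMr // contraction_entry.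
Qed.

End DiagonalPerturbation.

(** * Domination of contractions by orthogonal matrices *)

Section Domination.
Context {R : realType} {n : nat}.
Implicit Types (A D X Y : 'M[R]_n).

Lemma penalized_maximizer k D X : is_diag_mx D -> \det D != 0 ->
    contraction X ->
  exists Y, [/\ orthogonal_group Y, 0 < \det Y * \det D &
    penalized k D X X <= penalized k D X Y].
Proof.
move=> dD D0 cX.
have cpen : continuous (penalized k D X).
  move=> Y; apply: (continuousB (@continuous_mxdotr _ _ D Y)).
  apply: (continuousM (@cst_continuous _ _ k _)).
  exact: continuous_upper_sqdist.
have [|||Y /set_mem cY maxY] :=
    @compact_EVT_max _ R (penalized k D X) [set W | contraction W].
- by exists X.
- exact: compact_contraction.
- exact: continuous_subspaceT.
have {}maxY W : contraction W -> penalized k D X W <= penalized k D X Y.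
  by move=> cW; apply: maxY; exact/mem_set.
have ZY := penalized_argmax cY maxY; set Z := D + _ in ZY.
have ZD : \det Z = \det D by exact: det_diag_addr_upper.
have uZ : Z \in unitmx by rewrite unitmxE unitfE ZD.
exists Y; split; [exact: argmax_orthogonal ZY|by rewrite -ZD argmax_det_gt0|].
exact: maxY.
Qed.

(** G stands for O(n), or for SO(n) when det A >= 0. Instead of extracting a limit, the proof
    minimizes over G a defect h that is positive unless Y is as wanted; a positive minimum would be
    beaten by an approximate solution. *)
Lemma compact_domination (G : set 'M[R]_n) A X :
    compact G -> G `<=` @orthogonal_group R n -> is_diag_mx A ->
    (forall Y, orthogonal_group Y -> (0 <= \det A -> 0 < \det Y) -> G Y) ->
    contraction X ->
  exists Y, [/\ G Y, upper_part (Y - X) = 0 & mxdot A X <= mxdot A Y].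
Proof.
move=> cG GO dA OG cX.
have [S dS detS] := diag_perturbation dA.
have approx e k : 0 < e -> exists2 Y, G Y &
    mxdot (A + e *: S) X + k * mxdot (upper_part (Y - X)) (upper_part (Y - X))
    <= mxdot (A + e *: S) Y.
  move=> e0; have [De0 Dgt0] := detS _ e0.
  have dD : is_diag_mx (A + e *: S).
    apply/is_diag_mxP => i j ij; rewrite [LHS]mxE [in X in _ + X]mxE.
    by rewrite (is_diag_mxP dA) // (is_diag_mxP dS) // mulr0 addr0.
  have [Y [oY detY penY]] := @penalized_maximizer k _ _ dD De0 cX.
  exists Y.
    by apply: OG => // /Dgt0 D0; rewrite -(pmulr_lgt0 _ D0).
  move: penY; rewrite /penalized subrr.
  have -> : upper_part (0 : 'M[R]_n) = 0.
    by apply/matrixP => i j; rewrite !mxE if_same.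
  by rewrite /mxdot !mulmx0 mxtrace0 mulr0 subr0; lra.
pose a Y := mxdot A X - mxdot A Y.
(* The term |a| + a is twice the positive part of a, so h Y <= 0 means that the upper parts agree
   and a Y <= 0. *)
pose h Y := mxdot (upper_part (Y - X)) (upper_part (Y - X)) + (`|a Y| + a Y).
have ch : continuous h.
  have ca : continuous a.
    move=> Y; apply: (continuousB (@cst_continuous _ _ (mxdot A X) _)).
    exact: continuous_mxdotr.
  move=> Y; apply: (continuousD (@continuous_upper_sqdist _ _ X Y)).
  apply: (continuousD (continuous_comp (ca Y) (@norm_continuous _ _ _))).
  exact: ca.
have [|//||Y /set_mem GY minY] := @compact_EVT_min _ R h G.
- by have [Y GY _] := approx 1 1 ltr01; exists Y.
- exact: continuous_subspaceT.
have hY0 : h Y <= 0.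
  rewrite leNgt; apply/negP => hY.
  set b := \sum_j \sum_i `|A i j|; set c := \sum_j \sum_i `|S i j|.
  have b0 : 0 <= b by do 2!apply: sumr_ge0 => ? _.
  have c0 : 0 <= c by do 2!apply: sumr_ge0 => ? _.
  (* Here b and c bound |<A, .>| and |<S, .>| on contractions. The choice of e gives 2 e c <= h Y /
     4, and that of k gives (2 b + h Y) / k = h Y / 4. The approximant W then has penalty N <= h Y /
     4 and a W <= h Y / 4, so h W <= 3 h Y / 4 < h Y. *)
  pose e := h Y / (8 * (c + 1)).
  have e0 : 0 < e by rewrite divr_gt0 // mulr_gt0 //; lra.
  have ec : e * (8 * (c + 1)) = h Y.
    by rewrite divfK // gt_eqF // mulr_gt0 //; lra.
  pose k := 4 * (2 * b + h Y) / h Y.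
  have k0 : 0 < k by rewrite divr_gt0 // mulr_gt0 //; lra.
  have kh : k * h Y = 4 * (2 * b + h Y) by rewrite divfK // gt_eqF.
  have [W GW] := approx e k e0.
  have cW : contraction W by exact/orthogonal_contraction/GO.
  have := minY _ (mem_set GW); rewrite {2}/h /a !mxdot_lin.
  have := mxdot_contraction_le A cX; have := mxdot_contraction_le A cW.
  have := mxdot_contraction_le S cX; have := mxdot_contraction_le S cW.
  rewrite -/b -/c !ler_norml.
  have := mxdot_ge0 (upper_part (W - X)).
  move: (mxdot (upper_part _) _) (mxdot A X) (mxdot A W) => N x w.
  move: (mxdot S X) (mxdot S W) => x' w'.
  move=> N0 /andP[w'1 w'2] /andP[x'1 x'2] /andP[w1 w2] /andP[x1 x2] minW kN.
  have ex : e * (w' - x') <= e * (2 * c) by rewrite ler_pM2l //; lra.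
  have kNle : k * N <= 2 * b + h Y by lra.
  have Nle : N * 4 <= h Y by rewrite -(ler_pM2l k0); lra.
  have kN0 : 0 <= k * N by rewrite mulr_ge0 // ltW.
  by case: (ler0P (x - w)) minW => ? minW; lra.
have N0 := mxdot_ge0 (upper_part (Y - X)).
have aY0 : a Y <= 0.
  have := ler_norm (a Y); have := normr_ge0 (a Y); rewrite /h in hY0; lra.
exists Y; split=> //; last by rewrite -subr_le0.
apply/eqP; rewrite -mxdot_eq0 eq_le N0 andbT.
by move: hY0; rewrite /h ler0_norm // addNr addr0.
Qed.

Lemma hypo_proj_image_eq (G : set 'M[R]_n) A :
    compact G -> G `<=` @orthogonal_group R n -> is_diag_mx A ->
    (forall Y, orthogonal_group Y -> (0 <= \det A -> 0 < \det Y) -> G Y) ->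
  [set hypo_proj A X g | X in G & g in [set g : R | 0 <= g]] =
  [set hypo_proj A X g | X in @opnorm_ball R n & g in [set g : R | 0 <= g]].
Proof.
move=> cG GO dA OG; rewrite opnorm_ballE.
apply/seteqP; split=> _ [X GX [g /= g0 <-]].
  by exists X; [exact/orthogonal_contraction/GO|exists g].
have [Y [GY YX AXY]] := compact_domination cG GO dA OG GX.
(* The slack g absorbs the gain <A, Y> - <A, X>, leaving the first coordinate unchanged. *)
exists Y => //; exists (g + (mxdot A Y - mxdot A X)).
  by rewrite /= addr_ge0 // subr_ge0.
congr col_mx.
  by congr (_%:M); rewrite /frobenius_inner -/(mxdot A Y) -/(mxdot A X); ring.
apply/upper_projP => i j ij; have := congr1 (fun M : 'M_n => M i j) YX.
by rewrite !mxE ij => /eqP; rewrite subr_eq0 => /eqP.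
Qed.

End Domination.

Theorem corollary3 (R : realType) (n : nat) (A : 'M[R]_n)
    (A_diag : is_diag_mx A) :
  [set hypo_proj A X g | X in @orthogonal_group R n & g in [set g : R | 0 <= g]] =
  [set hypo_proj A X g | X in @opnorm_ball R n & g in [set g : R | 0 <= g]]
  /\
  (0 <= \det A ->
   [set hypo_proj A X g |
      X in @special_orthogonal_group R n & g in [set g : R | 0 <= g]] =
   [set hypo_proj A X g | X in @opnorm_ball R n & g in [set g : R | 0 <= g]]).
Proof.
split=> [|A0]; apply: hypo_proj_image_eq => //.
- exact: compact_orthogonal_group.
- exact: compact_special_orthogonal_group.
- by move=> X [].
(* An orthogonal matrix has a determinant of square 1, so a positive determinant equals 1. *)
move=> Y oY /(_ A0) Y0; split=> //; apply/eqP.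
have /(congr1 determinant) := oY; rewrite det_mulmx det_tr det1 -expr2 => /eqP.
by rewrite sqrp_eq1 // ltW.
Qed.
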